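(* Let $m\ge 2$ be an integer, let $G=K_{2m,2m}$ be the complete bipartite graph with both parts of size $2m$, and put $n=4m$ (the order of $G$) and $k=3m$. Then $$\mu_k(G)\,\mu_k(\overline G)=n(n-k),$$ and neither $G$ nor $\overline G$ is isomorphic to a join $K_k\vee H$ in which $H$ is a graph with $n-k$ vertices and at least $k+1$ connected components.
   Context: All graphs are finite and simple. For a graph $G$ of order $n$, $\overline G$ denotes its complement, and $L(G)=D(G)-A(G)$ denotes its Laplacian matrix, where $D(G)$ is the diagonal matrix of vertex degrees and $A(G)$ is the adjacency matrix. The eigenvalues of $L(G)$, counted with multiplicity, are written in non-increasing order as $\mu_1(G)\ge\mu_2(G)\ge\cdots\ge\mu_n(G)=0$. $K_k$ is the complete graph on $k$ vertices. The join $G_1\vee G_2$ of two graphs is obtained from their disjoint union by adding all edges between vertices of $G_1$ and vertices of $G_2$. *)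

(* Defs.v *)
From HB Require Import structures.
From mathcomp Require Import all_boot all_order all_algebra.
From mathcomp Require Import polyrcf.

Set Implicit Arguments.
Unset Strict Implicit.
Unset Printing Implicit Defensive.

Import Order.TTheory GRing.Theory Num.Theory.

Record sgraph := SGraph {
  vertex :> finType;
  edge : rel vertex;
  edge_sym : symmetric edge;
  edge_irrefl : irreflexive edge }.

Definition isomorphic (G H : sgraph) : Prop :=
  exists2 f : G -> H, bijective f & forall x y, edge (f x) (f y) = edge x y.

Section Complement.
Variable G : sgraph.
Definition compl_edge : rel G := fun x y => (x != y) && ~~ edge x y.
Lemma compl_edge_sym : symmetric compl_edge.
Proof. by move=> x y; rewrite /compl_edge eq_sym edge_sym. Qed.
Lemma compl_edge_irrefl : irreflexive compl_edge.
Proof. by move=> x; rewrite /compl_edge eqxx. Qed.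
Definition complement : sgraph := SGraph compl_edge_sym compl_edge_irrefl.
End Complement.

Section Complete.
Variable n : nat.
Definition complete_edge : rel 'I_n := fun i j => i != j.
Lemma complete_edge_sym : symmetric complete_edge.
Proof. by move=> i j; rewrite /complete_edge eq_sym. Qed.
Lemma complete_edge_irrefl : irreflexive complete_edge.
Proof. by move=> i; rewrite /complete_edge eqxx. Qed.
Definition complete : sgraph := SGraph complete_edge_sym complete_edge_irrefl.
End Complete.

Section CompleteBipartite.
Variables p q : nat.
Definition bipartite_edge : rel ('I_p + 'I_q)%type := fun x y =>
  match x, y with
  | inl _, inr _ | inr _, inl _ => true
  | inl _, inl _ | inr _, inr _ => false
  end.
Lemma bipartite_edge_sym : symmetric bipartite_edge.
Proof. by case=> i [] j. Qed.
Lemma bipartite_edge_irrefl : irreflexive bipartite_edge.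
Proof. by case. Qed.
Definition complete_bipartite : sgraph :=
  SGraph bipartite_edge_sym bipartite_edge_irrefl.
End CompleteBipartite.

Lemma card_complete_bipartite (p q : nat) : #|complete_bipartite p q| = p + q.
Proof. by rewrite card_sum !card_ord. Qed.

Section Join.
Variables G H : sgraph.
Definition join_edge : rel (G + H)%type := fun x y =>
  match x, y with
  | inl u, inl v => edge u v
  | inr u, inr v => edge u v
  | inl _, inr _ | inr _, inl _ => true
  end.
Lemma join_edge_sym : symmetric join_edge.
Proof. by case=> u [] v //=; apply: edge_sym. Qed.
Lemma join_edge_irrefl : irreflexive join_edge.
Proof. by case=> u /=; apply: edge_irrefl. Qed.
Definition join : sgraph := SGraph join_edge_sym join_edge_irrefl.
End Join.

Definition num_components (G : sgraph) : nat := n_comp (@edge G) predT.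

Definition degree (G : sgraph) (x : G) : nat := #|[set y | edge x y]|.

Local Open Scope ring_scope.

Section Laplacian.
Variables (R : rcfType) (G : sgraph).

(* Rows and columns are indexed through the enumeration [enum_val] of the
   vertices; the characteristic polynomial does not depend on it. *)
Definition adjacency_mx : 'M[R]_#|G| :=
  \matrix_(i, j) (edge (enum_val i) (enum_val j))%:R.

Definition degree_mx : 'M[R]_#|G| :=
  diag_mx (\row_i (degree (enum_val i))%:R).

Definition laplacian : 'M[R]_#|G| := degree_mx - adjacency_mx.

(* [rootsR] lists each root in R once, hence the repetition by [mup]. No
   eigenvalue is missed, [laplacian] being a symmetric matrix over a real
   closed field. *)
Definition laplacian_spectrum : seq R :=
  let p := char_poly laplacian in
  sort >=%R (flatten [seq nseq (mup x p) x | x <- rootsR p]).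

(* Numbered from 1: the largest eigenvalue is [mu 1]. *)
Definition mu (k : nat) : R := nth 0 laplacian_spectrum k.-1.

Lemma laplacian_spectrumP (s : seq R) :
  char_poly laplacian = \prod_(a <- s) ('X - a%:P) -> sorted >=%R s ->
  laplacian_spectrum = s.
Proof.
move=> ps srt; rewrite /laplacian_spectrum ps; set p := \prod_(a <- s) _.
have pn0 : p != 0 by rewrite monic_neq0 ?monic_prod_XsubC.
have mupE x : mup x p = count_mem x s.
  rewrite /p; elim: (s) => [|a t IH]; first by rewrite big_nil mupNroot ?root1.
  rewrite big_cons mupM ?polyXsubC_eq0 ?monic_neq0 ?monic_prod_XsubC //.
  by rewrite IH -['X - _]expr1 mup_XsubCX /= eq_sym; case: eqP.
have getr : transitive (>=%R : rel R) by move=> ? ? ? /[swap]; apply: le_trans.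
have geasym : antisymmetric (>=%R : rel R).
  by move=> x y; rewrite andbC => /le_anti.
apply: (sorted_eq getr geasym) => //.
  by apply: sort_sorted => x y; apply: le_total.
rewrite perm_sort; apply/allP => x _ /=; apply/eqP.
rewrite count_flatten -map_comp.
under eq_map => y do rewrite /= count_nseq /= mupE.
rewrite sumnE big_map.
have [xr|xr] := boolP (x \in rootsR p).
  rewrite (bigD1_seq x) ?uniq_roots //= eqxx mul1n big1 ?addn0 //.
  by move=> y /negPf ->.
rewrite big_seq big1 => [|y yr]; last first.
  by case: eqP yr xr => // -> ->.
apply/esym/eqP; rewrite -leqn0 leqNgt -has_count has_pred1 -root_prod_XsubC.
by rewrite -/p -(roots_on_rootsR pn0) in xr *.
Qed.

End Laplacian.

(* Main.v *)
Require Import Defs.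
From mathcomp Require Import all_boot all_order all_algebra.
Local Open Scope ring_scope.
Import Order.TTheory GRing.Theory Num.Theory.

(** With [p = 2m], the complete bipartite graph on two sides of size [p] and
    its complement (two disjoint copies of the complete graph on [p]
    vertices) have the Laplacians [p I - U W U^T], where [U] is the
    [2p x 2] matrix of the indicators of the two sides and [W] is a [2 x 2]
    matrix: the swap for the bipartite graph, the identity for its complement.
    Indeed the former is [p]-regular with [x], [y] adjacent iff their sides
    differ, while in the latter [x], [y] are adjacent or equal iff their sides
    agree, the missing diagonal entry being compensated by the degree [p - 1].

    So both Laplacians are the scalar [p] up to a correction of rank 2 and must
    have [p] as an eigenvalue with multiplicity at least [2p - 2]. The remaining
    two eigenvalues are read off from a [2 x 2] matrix, by Sylvester's
    determinant identity ([det_scalar_add_mulmx]) and [U^T U = p I]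
    ([side_mx_gram]): it is [p I - p W], with eigenvalues [0], [2p] for the
    bipartite graph and [0], [0] for its complement. The spectra are thus
    [2p, p, ..., p, 0] and [p, ..., p, 0, 0]. The index [k = 3m] lies in the
    range of the value [p] of both, as [3m <= 4m - 2] when [m >= 2], and the
    product is [(2m)^2 = 4m (4m - 3m)].

    The second claim is a matter of counting: a graph with [n - k = m] vertices
    has at most [m] components, hence fewer than [k + 1 = 3m + 1]. *)

(** * Scalar matrices perturbed in low rank *)

(** Sylvester's identity. Both sides are values of the determinant of [M],
    multiplied on the right by a block triangular matrix that clears the lower
    left block, respectively the upper right one. Multiplying by [c]
    instead of dividing by it keeps the identity valid over any commutative
    ring, here the polynomials. *)
Lemma det_scalar_add_mulmx {R : comNzRingType} {n r : nat}
    (c : R) (U : 'M[R]_(n, r)) (V : 'M[R]_(r, n)) :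
  \det (c%:M + U *m V) * c ^+ r = c ^+ n * \det (c%:M + V *m U).
Proof.
pose M := block_mx c%:M U (- V) 1%:M.
have detM : \det M = \det (c%:M + U *m V).
  have E : M *m block_mx 1%:M 0 V 1%:M = block_mx (c%:M + U *m V) U 0 1%:M.
    by rewrite mulmx_block !mulmx1 !mulmx0 mul1mx !add0r addNr.
  by move: (congr1 determinant E);
    rewrite det_mulmx det_lblock det_ublock !det1 !mulr1.
have E : M *m block_mx 1%:M (- U) 0 c%:M =
    block_mx c%:M 0 (- V) (c%:M + V *m U).
  rewrite mulmx_block !mulmx0 !mulmx1 !addr0 mul1mx !mulmxN mulNmx opprK.
  by rewrite mul_scalar_mx mul_mx_scalar addNr [V *m U + _]addrC.
by move: (congr1 determinant E);
  rewrite det_mulmx det_ublock det_lblock det1 mul1r !det_scalar detM.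
Qed.

Lemma char_poly_scalar_sub_mulmx {R : comNzRingType} {n r : nat}
    (d : R) (U : 'M[R]_(n, r)) (V : 'M[R]_(r, n)) :
  char_poly (d%:M - U *m V) * ('X - d%:P) ^+ r =
  ('X - d%:P) ^+ n * char_poly (d%:M - V *m U).
Proof.
have E k (B : 'M[R]_k) :
    char_poly_mx (d%:M - B) = ('X - d%:P)%:M + map_mx polyC B.
  by rewrite /char_poly_mx map_mxB map_scalar_mx opprB addrA addrAC raddfB.
by rewrite /char_poly !E !map_mxM det_scalar_add_mulmx.
Qed.

(** * Graphs on two blocks *)

Definition side {p : nat} (x : 'I_p + 'I_p) : 'I_2 :=
  if x is inl _ then ord0 else ord_max.

Lemma card_side (p : nat) (a : 'I_2) :
  #|[set x : 'I_p + 'I_p | side x == a]| = p.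
Proof.
rewrite -sum1_card big_sumType /=.
have [->|->] : a = ord0 \/ a = ord_max.
- by case: a => -[|[|//]] h; [left|right]; apply/val_inj.
- rewrite [X in (_ + X)%N]big1 => [|i]; last by rewrite inE.
  by under eq_bigl => i do rewrite inE eqxx; rewrite sum1_card card_ord addn0.
- rewrite [X in (X + _)%N]big1 => [|i]; last by rewrite inE.
  by under eq_bigl => i do rewrite inE eqxx; rewrite sum1_card card_ord.
Qed.

Section TwoBlocks.
Variables (R : idomainType) (p : nat).
Local Notation T := (('I_p + 'I_p)%type : finType).

Definition side_mx : 'M[R]_(#|T|, 2) :=
  \matrix_(i, a) (side (enum_val i) == a)%:R.

(** These are the matrices that depend only on the sides of the row and of the
    column. *)
Lemma side_mx_sandwich (W : 'M[R]_2) (i j : 'I_#|T|) :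
  (side_mx *m (W *m side_mx^T)) i j = W (side (enum_val i)) (side (enum_val j)).
Proof.
rewrite !mxE (bigD1 (side (enum_val i))) //= !mxE eqxx mul1r.
rewrite (bigD1 (side (enum_val j))) //= !mxE eqxx mulr1.
by rewrite !big1 ?addr0 // => a ne;
  rewrite !mxE eq_sym (negPf ne) ?mul0r ?mulr0.
Qed.

Lemma side_mx_gram : side_mx^T *m side_mx = p%:R%:M.
Proof.
apply/matrixP => a b; rewrite !mxE.
under eq_bigr => i _ do rewrite !mxE -natrM mulnb.
rewrite -natr_sum.
rewrite -(big_enum_val (fun x : T => (side x == a) && (side x == b) : nat)).
case: eqVneq => [<-|ne].
  rewrite mulr1n -[p in RHS](card_side p a) -sum1dep_card; congr _%:R.
  by rewrite [RHS]big_mkcond; apply: eq_bigr => x _; rewrite andbb.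
by rewrite big1 // => x _; case: eqP => // ->; rewrite (negPf ne).
Qed.

(** The [2 x 2] matrix is the quotient matrix with respect to the partition of
    the vertices into the two sides. Positivity of [p] only makes the truncated
    exponent [2 * p - 2] right. *)
Lemma char_poly_two_blocks (W : 'M[R]_2) :
  (0 < p)%N ->
  char_poly (p%:R%:M - side_mx *m (W *m side_mx^T)) =
  ('X - p%:R%:P) ^+ (2 * p - 2) * char_poly (p%:R%:M - p%:R *: W).
Proof.
move=> p0; have nz : ('X - p%:R%:P : {poly R}) ^+ 2 != 0.
  by rewrite expf_neq0 ?polyXsubC_eq0.
apply: (mulIf nz); rewrite char_poly_scalar_sub_mulmx -mulmxA side_mx_gram.
rewrite mul_mx_scalar mulrAC -exprD subnK; last by rewrite leq_pmulr.
by rewrite card_sum !card_ord mul2n addnn.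
Qed.
End TwoBlocks.

(** * The two Laplacian spectra *)

Lemma laplacian_complete_bipartite (R : rcfType) (p : nat) :
  laplacian R (complete_bipartite p p) =
  p%:R%:M - side_mx R p *m ((const_mx 1 - 1%:M) *m (side_mx R p)^T).
Proof.
apply/matrixP => i j; rewrite mxE [in RHS]mxE; congr (_ + _).
  rewrite !mxE -(inj_eq enum_val_inj) /degree; congr (_%:R *+ _).
  (* The neighbours of a vertex form the other side, whose index in ['I_2] is
     the truth value of the test that the vertex is on side 0. *)
  rewrite -[RHS](card_side p (side (enum_val i) == ord0)%:R).
  apply: eq_card => y; rewrite !inE.
  by case: (enum_val i) y => u [] v.
rewrite mxE [RHS]mxE side_mx_sandwich !mxE; congr (- _).
by case: (enum_val i) (enum_val j) => u [] v /=; rewrite ?subrr ?subr0.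
Qed.

Lemma laplacian_compl_complete_bipartite (R : rcfType) (p : nat) :
  laplacian R (complement (complete_bipartite p p)) =
  p%:R%:M - side_mx R p *m (1%:M *m (side_mx R p)^T).
Proof.
apply/matrixP => i j; rewrite mxE [in RHS]mxE [in X in _ = _ + X]mxE.
rewrite side_mx_sandwich !mxE -!(inj_eq enum_val_inj) /=.
set x := enum_val i; set y := enum_val j.
case: eqVneq => [<-|ne]; last first.
  by rewrite /compl_edge ne !mulr0n; case: (x) (y) => u [] v.
(* A vertex of the complement is joined to its own side except itself. *)
have degS : ((degree (x : complement (complete_bipartite p p))).+1 = p)%N.
  rewrite -[RHS](card_side p (side x)) (cardsD1 x) inE eqxx /degree; congr _.+1.
  apply: eq_card => z; rewrite !inE /= /compl_edge eq_sym.
  by case: (x) z => u [] v.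
rewrite /compl_edge !eqxx subr0 !mulr1n; apply/eqP.
by rewrite eq_sym subr_eq natr1 degS.
Qed.

(** The swap is the all-ones matrix minus the identity, so this matrix is again
    a scalar perturbed in rank one, and the same determinant identity reduces
    it to size 1. *)
Lemma char_poly_two_blocks_swap (R : idomainType) (p : nat) :
  char_poly (p%:R%:M - p%:R *: (const_mx 1 - 1%:M) : 'M[R]_2) =
  'X * ('X - (2 * p)%:R%:P).
Proof.
have nz : ('X - (2 * p)%:R%:P : {poly R}) ^+ 1 != 0.
  by rewrite expf_neq0 ?polyXsubC_eq0.
apply: (mulIf nz).
have -> : p%:R%:M - p%:R *: (const_mx 1 - 1%:M) =
    (2 * p)%:R%:M - const_mx p%:R *m (const_mx 1 : 'rV_2) :> 'M[R]_2.
  apply/matrixP => a b; rewrite !mxE big_ord1 !mxE mulr1 mulrBr mulr1.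
  by rewrite mul2n -addnn natrD mulrnDl opprB mulr_natr addrA.
rewrite char_poly_scalar_sub_mulmx.
have -> : (2 * p)%:R%:M - (const_mx 1 : 'rV_2) *m const_mx p%:R = 0 :> 'M[R]_1.
  apply/matrixP => a b; rewrite !mxE !ord1 eqxx big_ord_recl big_ord1 !mxE.
  by rewrite mul1r -natrD addnn mul2n subrr.
by rewrite /char_poly /char_poly_mx raddf0 subr0 det_scalar expr1 mulrC mulrA.
Qed.

Lemma prod_nseq_XsubC (R : comNzRingType) (k : nat) (a : R) (s : seq R) :
  \prod_(b <- nseq k a ++ s) ('X - b%:P) =
  ('X - a%:P) ^+ k * \prod_(b <- s) ('X - b%:P).
Proof. by rewrite big_cat big_nseq -Monoid.iteropE. Qed.

Lemma path_ge_nseq_cat (R : realDomainType) (k : nat) (b a : R) (s : seq R) :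
  a <= b -> path >=%R a s -> path >=%R b (nseq k a ++ s).
Proof.
elim: k b => [|k IH] b ab srt /=; last by rewrite ab IH.
by case: s srt => //= c s /andP[ca ->]; rewrite (le_trans ca ab).
Qed.

Lemma spectrum_complete_bipartite (R : rcfType) (p : nat) :
  (0 < p)%N ->
  laplacian_spectrum R (complete_bipartite p p) =
  (2 * p)%:R :: nseq (2 * p - 2) p%:R ++ [:: 0].
Proof.
move=> p0; apply: laplacian_spectrumP.
  rewrite laplacian_complete_bipartite char_poly_two_blocks //.
  rewrite char_poly_two_blocks_swap big_cons prod_nseq_XsubC big_seq1 subr0.
  by rewrite mulrA mulrC.
by apply: path_ge_nseq_cat; rewrite ?ler_nat ?leq_pmull //= ler0n.
Qed.

Lemma spectrum_compl_complete_bipartite (R : rcfType) (p : nat) :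
  (0 < p)%N ->
  laplacian_spectrum R (complement (complete_bipartite p p)) =
  nseq (2 * p - 2) p%:R ++ [:: 0; 0].
Proof.
move=> p0; apply: laplacian_spectrumP.
  rewrite laplacian_compl_complete_bipartite char_poly_two_blocks //.
  rewrite scalemx1 subrr prod_nseq_XsubC big_cons big_seq1 subr0.
  by rewrite /char_poly /char_poly_mx raddf0 subr0 det_scalar.
apply: (@path_sorted _ _ p%:R).
by apply: path_ge_nseq_cat; rewrite //= ler0n lexx.
Qed.

Lemma mu_complete_bipartite (R : rcfType) (p k : nat) :
  (1 < k < 2 * p)%N -> mu R (complete_bipartite p p) k = p%:R.
Proof.
case: k => [|[|k]] // /andP[_ kp].
have p0 : (0 < p)%N by case: p kp.
rewrite /mu spectrum_complete_bipartite //= nth_cat size_nseq nth_nseq.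
by rewrite ltn_subRL add2n kp.
Qed.

Lemma mu_compl_complete_bipartite (R : rcfType) (p k : nat) :
  (0 < k <= 2 * p - 2)%N ->
  mu R (complement (complete_bipartite p p)) k = p%:R.
Proof.
case: k => [|k] // /andP[_ kp].
have p0 : (0 < p)%N by case: p kp.
rewrite /mu spectrum_compl_complete_bipartite // nth_cat size_nseq nth_nseq.
by rewrite kp.
Qed.

Lemma num_components_le_card (G : sgraph) : (num_components G <= #|G|)%N.
Proof. exact: max_card. Qed.

(** * The product of the eigenvalues and the joins *)

Theorem proposition1 (R : rcfType) (m : nat) (hm : (2 <= m)%N) :
  let G := complete_bipartite (2 * m) (2 * m) in
  let n := (4 * m)%N in
  let k := (3 * m)%N in
  mu R G k * mu R (complement G) k = n%:R * (n%:R - k%:R) /\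
  (forall H : sgraph,
     #|H| = (n - k)%N -> (k + 1 <= num_components H)%N ->
     ~ isomorphic G (join (complete k) H) /\
     ~ isomorphic (complement G) (join (complete k) H)).
Proof.
move=> G n k; split; last first.
  (* The order of [H] alone contradicts the number of its components. *)
  move=> H cardH many.
  have: (k + 1 <= n - k)%N.
    by rewrite -cardH (leq_trans many) ?num_components_le_card.
  by rewrite /n /k -mulnBl mul1n addn1 ltnNge leq_pmull.
have nE : n = (m + k)%N := mulSn 3 m.
have np : (2 * (2 * m))%N = n by rewrite mulnA.
have k_gt1 : (1 < k)%N by rewrite (leq_trans hm) ?leq_pmull.
have k_lt : (2 + k <= n)%N by rewrite nE leq_add2r.
rewrite mu_complete_bipartite ?mu_compl_complete_bipartite ?np.
- have -> : n%:R - k%:R = m%:R :> R by rewrite nE natrD addrK.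
  by rewrite -!natrM -[in RHS]np (mulnC 2 (2 * m)) -(mulnA (2 * m)).
- by rewrite (ltnW k_gt1) leq_subRL // (leq_trans _ k_lt) ?leq_addr.
- by rewrite k_gt1 ltnW.
Qed.
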